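(* Let $B>0$, let $R,S,T,P\in\mathbb{R}$, and fix $\gamma\ge0$. Let $U_1,U_2:[-B,B]^2\to\mathbb{R}$ be the induced payoffs of the symmetric $2\times2$ game with payoffs $R,S,T,P$ under the sigmoid semantics with coupling $\gamma$. For each $i\in\{1,2\}$ write $U_i(\theta_i,B)$ for player $i$'s payoff when her own parameter is $\theta_i$ and the opponent's parameter is $B$. Suppose that for each $i\in\{1,2\}$ the map $\theta_i\mapsto U_i(\theta_i,B)$ is differentiable on $(-B,B)$ and satisfies $$\frac{d}{d\theta_i}U_i(\theta_i,B)\ge0\qquad\text{for all }\theta_i\in(-B,B).$$ Then $(B,B)$ is a parametric program Nash equilibrium (PPNE).
   Context: Symmetric $2\times2$ game: two players, each with actions $C$ (cooperate) and $D$ (defect). A player receives $R$ if both play $C$, $S$ if she plays $C$ and the opponent plays $D$, $T$ if she plays $D$ and the opponent plays $C$, and $P$ if both play $D$. For player $i$, let $-i$ denote the other player. If player $i$ plays $C$ with probability $p_i$ (independently), player $i$'s expected payoff is $$u_i(p_1,p_2)=p_ip_{-i}R+p_i(1-p_{-i})S+(1-p_i)p_{-i}T+(1-p_i)(1-p_{-i})P .$$ Sigmoid semantics with coupling $\gamma\ge0$: player $i$ chooses a parameter $\theta_i\in[-B,B]$, and the profile $\theta=(\theta_1,\theta_2)$ determines her probability of playing $C$ as $p_i(\theta)=\sigma(\theta_i+\gamma\theta_{-i})$, where $\sigma(x)=(1+e^{-x})^{-1}$. The induced payoffs are $U_i(\theta)=u_i(p_1(\theta),p_2(\theta))$. PPNE: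 a profile $\theta^\star\in[-B,B]^2$ is a parametric program Nash equilibrium if, for every $i\in\{1,2\}$ and every $\theta_i\in[-B,B]$, $U_i(\theta_i^\star,\theta_{-i}^\star)\ge U_i(\theta_i,\theta_{-i}^\star)$, where the first argument is player $i$'s own parameter and the second the opponent's. *)

(* Defs.v *)
From Stdlib Require Import Reals.
From Coquelicot Require Import Coquelicot.

Open Scope R_scope.

Inductive player : Set := player1 | player2.

Definition opponent (i : player) : player :=
  match i with player1 => player2 | player2 => player1 end.

(* One real number per player: a parameter [theta i] or a probability [p i]. *)
Definition profile : Type := player -> R.

(* The profile in which player [i] has [x] and her opponent has [y]; it
   implements the convention that in [U_i(x, y)] the first argument belongs to
   player [i] herself, whichever player she is. *)
Definition own_opp (i : player) (x y : R) : profile :=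
  fun j => match i, j with
           | player1, player1 | player2, player2 => x
           | player1, player2 | player2, player1 => y
           end.

(* [rR], [rS], [rT], [rP] are the payoffs R (both cooperate), S (only she
   cooperates), T (only the opponent cooperates), P (both defect); [p i] is the
   probability with which player [i] independently cooperates. *)
Definition expected_payoff (rR rS rT rP : R) (i : player) (p : profile) : R :=
  p i * p (opponent i) * rR + p i * (1 - p (opponent i)) * rS
  + (1 - p i) * p (opponent i) * rT + (1 - p i) * (1 - p (opponent i)) * rP.

Definition sigmoid (x : R) : R := / (1 + exp (- x)).

Definition coop_prob (gamma : R) (theta : profile) : profile :=
  fun i => sigmoid (theta i + gamma * theta (opponent i)).

(* The formula makes sense for all real parameters; the restriction to
   [-B, B] is imposed where the payoffs are used. *)
Definition induced_payoff (rR rS rT rP gamma : R) (i : player)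
    (theta : profile) : R :=
  expected_payoff rR rS rT rP i (coop_prob gamma theta).

Definition PPNE (B : R) (U : player -> profile -> R) (theta : profile) : Prop :=
  (forall i : player, - B <= theta i <= B) /\
  (forall (i : player) (x : R), - B <= x <= B ->
     U i (own_opp i (theta i) (theta (opponent i)))
     >= U i (own_opp i x (theta (opponent i)))).

(* Main.v *)
Require Import Defs.
From Stdlib Require Import Reals Lra.
From Coquelicot Require Import Coquelicot.

Open Scope R_scope.

(** Against an opponent at [B], a player's payoff has nonnegative slope in her own parameter on the
    open interval, so by the mean value theorem no [x < B] beats [B]. *)

(** The payoff is polynomial in sigmoids, whose denominators [1 + exp z] never vanish. *)
Lemma ex_derive_induced_payoff_own (rR rS rT rP gamma : R) (i : player)
    (y x : R) :
  ex_derive (fun t => induced_payoff rR rS rT rP gamma i (own_opp i t y)) x.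
Proof.
  assert (pos : forall z, 1 + exp z <> 0)
    by (intro z; generalize (exp_pos z); lra).
  destruct i; unfold induced_payoff, expected_payoff, coop_prob, sigmoid; simpl;
    auto_derive; repeat split; apply pos.
Qed.

Theorem theorem4 (B rR rS rT rP gamma : R)
  (hB : 0 < B) (hgamma : 0 <= gamma)
  (hderiv : forall (i : player) (x : R), - B < x < B ->
     let Ui := fun t : R => induced_payoff rR rS rT rP gamma i (own_opp i t B) in
     ex_derive Ui x /\ Derive Ui x >= 0) :
  PPNE B (induced_payoff rR rS rT rP gamma) (fun _ : player => B).
Proof.
  split; [intros _; lra|].
  intros i x [hx [hxB | ->]]; [|apply Rge_refl].
  set (Ui := fun t : R => induced_payoff rR rS rT rP gamma i (own_opp i t B)).
  change (Ui B >= Ui x).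
  destruct (MVT_cor2 Ui (Derive Ui) x B hxB) as [c [hUi hc]].
  (* [MVT_cor2] wants differentiability on the closed interval from [x] to [B]; [hderiv] stops short
     of the endpoint [B], so the lemma supplies it. *)
  { intros c _. apply is_derive_Reals, Derive_correct.
    apply ex_derive_induced_payoff_own. }
  (* The point [c] lies strictly between [x] and [B], where the sign condition applies. *)
  destruct (hderiv i c ltac:(lra)) as [_ hdc]. fold Ui in hdc.
  assert (0 <= Derive Ui c * (B - x)) by (apply Rmult_le_pos; lra).
  lra.
Qed.
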